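(* For every integer $n\ge 0$, the functors $L^2_n$ and $D^2_n$ are artinian objects of $\mathcal{F}$.
   Context: $\mathcal{E}$ is the category of $\mathbb{F}_2$-vector spaces, $\mathcal{E}^f$ its full subcategory of finite-dimensional spaces, $\mathcal{F}$ the (abelian) category of functors $\mathcal{E}^f\to\mathcal{E}$, with pointwise tensor product $\otimes$ over $\mathbb{F}_2$; $\Lambda^n$ is the $n$-th exterior power functor. The duality $D:\mathcal{F}^{op}\to\mathcal{F}$ is $DF(V)=F(V^* )^*$; it commutes with tensor products and exterior powers of functors with finite-dimensional values, and exterior powers $\Lambda^n$ and $\Lambda^n(\Lambda^3)$ are identified with their duals. $\bar P$ is the functor $V\mapsto \mathbb{F}_2[V]/\mathbb{F}_2\cdot[0]$, where $\mathbb{F}_2[V]$ has basis $([v])_{v\in V}$ (so $[0]=0$ in $\bar P(V)$), and $\bar I=D\bar P$. The endomorphism $\Pi$ of $\Lambda^2(\bar P)$ given by $[u]\wedge[v]\mapsto([u]+[v])\wedge[u+v]$ ($u,v\in V\setminus\{0\}$) is idempotent; put $P_{2,1}=\mathrm{im}\,\Pi$, $\bar G(2)=\ker\Pi$, $L(2)=DP_{2,1}$, $\bar D(2)=D\bar G(2)$, so $\Lambda^2(\bar P)\simeq P_{2,1}\oplus\bar G(2)$ and $\Lambda^2(\bar I)\simeq L(2)\oplus\bar D(2)$. For $n\ge 1$ let $g_n:\Lambda^2(\bar P)\otimes\Lambda^n\to\Lambda^2(\bar P)\otimes\Lambda^n(\Lambda^3)$ be given by $([u]\wedge[v])\otimes(a_1\wedge\dots\wedge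 a_n)\mapsto([u]\wedge[v])\otimes\bigwedge_{1\le i\le n}(u\wedge v\wedge a_i)$. It commutes with $\Pi$ (tensored with identities), hence is the direct sum of morphisms $g^L_n:P_{2,1}\otimes\Lambda^n\to P_{2,1}\otimes\Lambda^n(\Lambda^3)$ and $g^D_n:\bar G(2)\otimes\Lambda^n\to\bar G(2)\otimes\Lambda^n(\Lambda^3)$. Define $L^2_n=\mathrm{im}(Dg^L_n)\subset L(2)\otimes\Lambda^n$ and $D^2_n=\mathrm{im}(Dg^D_n)\subset\bar D(2)\otimes\Lambda^n$ for $n\geq 1$, and $L^2_0=L(2)$, $D^2_0=\bar D(2)$. An object is artinian if every decreasing sequence of subobjects stabilizes. *)

(* Defs.v *)
From HB Require Import structures.
From mathcomp Require Import all_boot all_algebra.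
From mathcomp Require Import boolp.
From mathcomp Require Import freeg.

Set Implicit Arguments.
Unset Strict Implicit.
Unset Printing Implicit Defensive.

Import GRing.Theory.
Local Open Scope ring_scope.

Notation F2 := 'F_2.

Lemma addvv (M : lmodType F2) (x : M) : x + x = 0.
Proof. by rewrite -mulr2n -scaler_nat pchar_Fp_0 // scale0r. Qed.

Lemma oppv (M : lmodType F2) (x : M) : - x = x.
Proof. by apply/esym/eqP; rewrite -addr_eq0 addvv. Qed.

Section Linear.
Variables M N : lmodType F2.

Definition mklin (f : M -> N) (H : linear f) : {linear M -> N} :=
  HB.pack f (GRing.isLinear.Build F2 M N *:%R f H).

Lemma lin_ext (f g : {linear M -> N}) : f =1 g -> f = g.
Proof.
case: f g => [f [[Sf] [Df]]] [g [[Sg] [Dg]]] /= /funext efg.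
move: efg Sg Dg => <- Sg Dg; congr GRing.Linear.Pack.
by congr GRing.Linear.Class;
  [congr Algebra.isNmodMorphism.Axioms_ | congr GRing.isScalable.Axioms_];
  apply: Prop_irrelevance.
Qed.

End Linear.

Definition ldual (M : lmodType F2) : Type := {linear M -> F2^o}.

Section Dual.
Variable M : lmodType F2.
Implicit Types f g : ldual M.

HB.instance Definition _ := gen_eqMixin (ldual M).
HB.instance Definition _ := gen_choiceMixin (ldual M).

Definition dual0 : ldual M := (\0 : M -> F2^o) : {linear M -> F2^o}.
Definition dual_add f g : ldual M :=
  ((f : {linear _ -> _}) \+ (g : {linear _ -> _}) : M -> F2^o)
    : {linear M -> F2^o}.
Definition dual_opp f : ldual M :=
  (\- (f : {linear _ -> _}) : M -> F2^o) : {linear M -> F2^o}.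
Definition dual_scale (a : F2) f : ldual M :=
  (a \*: (f : {linear _ -> _}) : M -> F2^o) : {linear M -> F2^o}.

Fact dual_addA : associative dual_add.
Proof. by move=> f g h; apply: lin_ext => x /=; rewrite addrA. Qed.
Fact dual_addC : commutative dual_add.
Proof. by move=> f g; apply: lin_ext => x /=; rewrite addrC. Qed.
Fact dual_add0 : left_id dual0 dual_add.
Proof. by move=> f; apply: lin_ext => x /=; rewrite add0r. Qed.
Fact dual_addN : left_inverse dual0 dual_opp dual_add.
Proof. by move=> f; apply: lin_ext => x /=; rewrite addNr. Qed.

HB.instance Definition _ :=
  GRing.isZmodule.Build (ldual M) dual_addA dual_addC dual_add0 dual_addN.

Fact dual_scaleA a b f : dual_scale a (dual_scale b f) = dual_scale (a * b) f.
Proof. by apply: lin_ext => x /=; rewrite scalerA. Qed.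
Fact dual_scale1 : left_id 1 dual_scale.
Proof. by move=> f; apply: lin_ext => x /=; rewrite scale1r. Qed.
Fact dual_scaleDr : right_distributive dual_scale +%R.
Proof. by move=> a f g; apply: lin_ext => x /=; rewrite scalerDr. Qed.
Fact dual_scaleDl f : {morph dual_scale^~ f : a b / a + b}.
Proof. by move=> a b; apply: lin_ext => x /=; rewrite scalerDl. Qed.

HB.instance Definition _ := GRing.Zmodule_isLmodule.Build F2 (ldual M)
  dual_scaleA dual_scale1 dual_scaleDr dual_scaleDl.

End Dual.

Section DualMap.
Variables (M N : lmodType F2) (h : {linear M -> N}).

Definition dual_map_fun (f : ldual N) : ldual M :=
  ((f : {linear N -> F2^o}) \o h) : {linear M -> F2^o}.

Fact dual_map_linear : linear dual_map_fun.
Proof. by move=> a f g; apply: lin_ext => x. Qed.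

Definition dual_map : {linear ldual N -> ldual M} := mklin dual_map_linear.
End DualMap.

Section Subspace.
Variables (M : lmodType F2) (S : submodClosed M).

Record subspace := Subspace { subval : M; subvalP : subval \in S }.

HB.instance Definition _ := [isSub for subval].
HB.instance Definition _ := [Choice of subspace by <:].
HB.instance Definition _ := [SubChoice_isSubLmodule of subspace by <:].

Fact subval_linear : linear subval.
Proof. by move=> a x y. Qed.
Definition subval_lin : {linear subspace -> M} := mklin subval_linear.

Lemma subspace_ext (x y : subspace) : subval x = subval y -> x = y.
Proof. exact: val_inj. Qed.
End Subspace.

Section Span.
Variables (M : lmodType F2) (R : M -> Prop).

Inductive relspan : M -> Prop :=
| relspan0 : relspan 0
| relspanZD a r x : R r -> relspan x -> relspan (a *: r + x).

Definition relspan_pred : {pred M} := fun x => `[< relspan x >].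

Fact relspan_closed : submod_closed relspan_pred.
Proof.
split; first by apply/asboolP; apply: relspan0.
move=> b x y /asboolP Sx /asboolP Sy; apply/asboolP.
elim: Sx => [|a r z Rr _ IH]; first by rewrite scaler0 add0r.
by rewrite scalerDr scalerA -addrA; apply: relspanZD.
Qed.

HB.instance Definition _ := GRing.isSubmodClosed.Build F2 M relspan_pred relspan_closed.
End Span.

Section Quotient.
Variables (M : lmodType F2) (S : submodClosed M).

Definition quot_mod : {pred M} := fun x => x \in S.
Fact quot_mod_closed : zmod_closed quot_mod.
Proof.
split; first exact: rpred0.
by move=> x y Sx Sy; rewrite -topredE /= /quot_mod rpredD // -scaleN1r rpredZ.
Qed.
HB.instance Definition _ := GRing.isZmodClosed.Build M quot_mod quot_mod_closed.

Definition quot_space : Type := ring_quotient.Quotient.quot quot_mod.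
HB.instance Definition _ := GRing.Zmodule.on quot_space.

Definition proj (x : M) : quot_space := (\pi_(ring_quotient.Quotient.quot quot_mod) x)%qT.
Definition qrepr (q : quot_space) : M := generic_quotient.repr q.

Fact qreprK : cancel qrepr proj.
Proof. exact: generic_quotient.reprK. Qed.

Fact proj_eq x y : (proj x = proj y) <-> (x - y \in S).
Proof.
have E := ring_quotient.Quotient.idealrBE quot_mod x y.
split=> [exy|Sxy]; last by apply/eqP; rewrite /proj -E.
by have: x - y \in quot_mod by rewrite E; apply/eqP.
Qed.

Fact projB : {morph proj : x y / x - y}.
Proof. exact: (raddfB (\pi_(ring_quotient.Quotient.quot quot_mod))%qT). Qed.

Definition quot_scale (a : F2) (q : quot_space) : quot_space :=
  proj (a *: qrepr q).

Fact projZ a x : proj (a *: x) = quot_scale a (proj x).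
Proof.
apply/proj_eq; rewrite -scalerBr rpredZ //; apply/proj_eq.
by rewrite qreprK.
Qed.

Fact quot_scaleA a b q : quot_scale a (quot_scale b q) = quot_scale (a * b) q.
Proof. by rewrite -[q]qreprK -!projZ scalerA. Qed.
Fact quot_scale1 : left_id 1 quot_scale.
Proof. by move=> q; rewrite -[q]qreprK -!projZ scale1r. Qed.
Fact projD : {morph proj : x y / x + y}.
Proof. exact: (raddfD (\pi_(ring_quotient.Quotient.quot quot_mod))%qT). Qed.
Fact quot_scaleDr : right_distributive quot_scale +%R.
Proof.
move=> a p q; rewrite -[p]qreprK -[q]qreprK.
by rewrite -!projZ -!projD -projZ scalerDr.
Qed.
Fact quot_scaleDl q : {morph quot_scale^~ q : a b / a + b}.
Proof. by move=> a b; rewrite -[q]qreprK -!projZ -projD scalerDl. Qed.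

HB.instance Definition _ := GRing.Zmodule_isLmodule.Build F2 quot_space
  quot_scaleA quot_scale1 quot_scaleDr quot_scaleDl.

Fact proj_linear : linear proj.
Proof. by move=> a x y; rewrite projD projZ. Qed.
Fact proj0 : proj 0 = 0.
Proof. by rewrite -(subrr 0) projB subrr. Qed.
Fact proj_scale a x : proj (a *: x) = a *: proj x.
Proof. exact: projZ. Qed.
Definition proj_lin : {linear M -> quot_space} := mklin proj_linear.

End Quotient.

Section Presentation.
Variables (X : choiceType) (R : {freeg X / F2} -> Prop).

(* The vector space with generators [X] and relations [r = 0] for [R r]. *)
Definition pres : lmodType F2 := quot_space (relspan_pred R).
Definition pgen (x : X) : pres := proj (relspan_pred R) << x >>.

Fact gen_rel (r : {freeg X / F2}) : R r -> proj (relspan_pred R) r = 0.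
Proof.
move=> Rr; rewrite -(proj0 (relspan_pred R)); apply/proj_eq.
rewrite subr0; apply/asboolP; rewrite -[r]scale1r -[_ *: _]addr0.
exact/relspanZD/relspan0.
Qed.

Section FreeLift.
Variables (M : lmodType F2) (f : X -> M).

Fact free_lift_linear : linear (fglift f).
Proof.
have B : {morph fglift f : x y / x - y} := lift_is_additive f.
have L0 : fglift f 0 = 0 by rewrite -(subrr 0) B subrr.
have DE : {morph fglift f : x y / x + y}.
  by move=> x y; rewrite -{1}(opprK y) B -(sub0r y) B L0 sub0r opprK.
move=> a x y; rewrite DE; congr (_ + _).
have [|] : a = 0 \/ a = 1.
- case: a => [[|[|//]] Ha]; [left | right]; exact: val_inj.
- by move=> ->; rewrite !scale0r.
- by move=> ->; rewrite !scale1r.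
Qed.
Definition free_lift : {linear {freeg X / F2} -> M} := mklin free_lift_linear.

Fact free_liftE x : free_lift << x >> = f x.
Proof. by rewrite /= liftU scale1r. Qed.

Definition pres_lift_fun (q : pres) : M := free_lift (qrepr q).

(* [f] respects the relations, so that it extends to a linear map on [pres]. *)
Definition compat := forall r, R r -> free_lift r = 0.

Fact span_lift r : compat -> relspan R r -> free_lift r = 0.
Proof.
by move=> fR; elim=> [|a s x /fR s0 _ IH]; rewrite ?linear0 // linearP s0 scaler0 add0r.
Qed.

Hypothesis fR : compat.

Fact pres_lift_proj r : pres_lift_fun (proj (relspan_pred R) r) = free_lift r.
Proof.
apply/eqP; rewrite -subr_eq0 -linearB; apply/eqP/span_lift => //.
by apply/asboolP/(@proj_eq _ (relspan_pred R)); rewrite qreprK.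
Qed.

Fact pres_lift_linear : linear pres_lift_fun.
Proof.
move=> a p q; rewrite -[p]qreprK -[q]qreprK.
by rewrite -proj_scale -projD !pres_lift_proj linearP.
Qed.

Definition pres_lift : {linear pres -> M} := mklin pres_lift_linear.

Fact pres_liftE x : pres_lift (pgen x) = f x.
Proof. by rewrite /= pres_lift_proj free_liftE. Qed.
End FreeLift.

Fact pres_ext (M : lmodType F2) (f g : {linear pres -> M}) :
  (forall x, f (pgen x) = g (pgen x)) -> f =1 g.
Proof.
move=> fg q; rewrite -[q]qreprK; move: (qrepr q) => r {q}.
elim/freeg_ind_dom0: r => [|k x D _ _ IH].
  by rewrite proj0 !linear0.
rewrite projD !linearD /= IH; congr (_ + _).
have -> : << k *g x >> = k *: << x >> :> {freeg X / F2}.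
  by apply/eqP/freeg_eqP => y; rewrite coeffZ !coeffU mul1r.
by rewrite proj_scale !linearZ /=; congr (_ *: _); apply: fg.
Qed.

End Presentation.
Global Opaque pres_lift.

Section Tensor.
Variables M N : lmodType F2.

Inductive tens_rel : {freeg (M * N) / F2} -> Prop :=
| tens_linl a x x' y :
    tens_rel (<< (a *: x + x', y) >> - (a *: << (x, y) >> + << (x', y) >>))
| tens_linr a x y y' :
    tens_rel (<< (x, a *: y + y') >> - (a *: << (x, y) >> + << (x, y') >>)).

Definition tensor : lmodType F2 := pres tens_rel.
Definition tens (x : M) (y : N) : tensor := pgen tens_rel (x, y).

Fact tens_is_linearl y : linear (tens^~ y).
Proof.
move=> a x x'; apply/eqP; rewrite -subr_eq0; apply/eqP.
have := gen_rel (tens_linl a x x' y).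
by rewrite projB projD proj_scale.
Qed.
Fact tens_is_linearr x : linear (tens x).
Proof.
move=> a y y'; apply/eqP; rewrite -subr_eq0; apply/eqP.
have := gen_rel (tens_linr a x y y').
by rewrite projB projD proj_scale.
Qed.
Definition tensl y : {linear M -> tensor} := mklin (tens_is_linearl y).
Definition tensr x : {linear N -> tensor} := mklin (tens_is_linearr x).

Fact tens0l y : tens 0 y = 0.
Proof. exact: (linear0 (tensl y)). Qed.
Fact tensDl x x' y : tens (x + x') y = tens x y + tens x' y.
Proof. exact: (linearD (tensl y)). Qed.

Fact tens_ext (P : lmodType F2) (f g : {linear tensor -> P}) :
  (forall x y, f (tens x y) = g (tens x y)) -> f =1 g.
Proof. by move=> fg; apply: pres_ext => -[x y]; apply: fg. Qed.

Section TensorLift.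
Variables (P : lmodType F2) (b : M -> N -> P).
Hypotheses (bl : forall y, linear (b^~ y)) (br : forall x, linear (b x)).

Fact tens_compat : compat tens_rel (fun p => b p.1 p.2).
Proof.
move=> r [] *; rewrite linearB linearD linearZ !free_liftE /=.
  by rewrite bl subrr.
by rewrite br subrr.
Qed.
Definition tens_lift : {linear tensor -> P} := pres_lift tens_compat.
Fact tens_liftE x y : tens_lift (tens x y) = b x y.
Proof. exact: pres_liftE. Qed.
End TensorLift.
End Tensor.
Global Opaque tensor tens tens_lift.

Section TensorMap.
Variables (M M' N N' : lmodType F2).
Variables (f : {linear M -> M'}) (g : {linear N -> N'}).

Fact tens_map_linl y : linear (fun x => tens (f x) (g y)).
Proof. by move=> a x x'; rewrite linearP tens_is_linearl. Qed.
Fact tens_map_linr x : linear (fun y => tens (f x) (g y)).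
Proof. by move=> a y y'; rewrite linearP tens_is_linearr. Qed.

Definition tens_map : {linear tensor M N -> tensor M' N'} :=
  tens_lift tens_map_linl tens_map_linr.

Fact tens_mapE x y : tens_map (tens x y) = tens (f x) (g y).
Proof. exact: tens_liftE. Qed.
End TensorMap.
Global Opaque tens_map.

Section Exterior.
Variables (n : nat) (M : lmodType F2).
Implicit Types (t : {ffun 'I_n -> M}) (i j : 'I_n).

Definition upd t i x : {ffun 'I_n -> M} :=
  [ffun k => if k == i then x else t k].

(* Alternation has to be imposed by [ext_alt]: in characteristic 2 it does not
   follow from antisymmetry. *)
Inductive ext_rel : {freeg {ffun 'I_n -> M} / F2} -> Prop :=
| ext_lin t i a x y :
    ext_rel (<< upd t i (a *: x + y) >>
               - (a *: << upd t i x >> + << upd t i y >>))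
| ext_alt t i j : i != j -> t i = t j -> ext_rel << t >>.

Definition extpow : lmodType F2 := pres ext_rel.
Definition wedge t : extpow := pgen ext_rel t.

Fact wedge_lin t i : linear (fun x => wedge (upd t i x)).
Proof.
move=> a x y; apply/eqP; rewrite -subr_eq0; apply/eqP.
have := gen_rel (ext_lin t i a x y).
by rewrite projB projD proj_scale.
Qed.
Fact wedge_alt t i j : i != j -> t i = t j -> wedge t = 0.
Proof. by move=> ij tij; exact: (gen_rel (ext_alt ij tij)). Qed.

Section ExteriorLift.
Variables (P : lmodType F2) (b : {ffun 'I_n -> M} -> P).
Hypothesis bl : forall t i, linear (fun x => b (upd t i x)).
Hypothesis b0 : forall t i j, i != j -> t i = t j -> b t = 0.

Fact ext_compat : compat ext_rel b.
Proof.
move=> r [t i a x y|t i j ij tij]; last by rewrite free_liftE (b0 ij).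
by rewrite linearB linearD linearZ !free_liftE bl subrr.
Qed.
Definition ext_lift : {linear extpow -> P} := pres_lift ext_compat.
Fact ext_liftE t : ext_lift (wedge t) = b t.
Proof. exact: pres_liftE. Qed.
End ExteriorLift.

Fact ext_ext (P : lmodType F2) (f g : {linear extpow -> P}) :
  (forall t, f (wedge t) = g (wedge t)) -> f =1 g.
Proof. by move=> fg; apply: pres_ext => t; apply: fg. Qed.
End Exterior.
Global Opaque extpow wedge ext_lift.

Section ExteriorMap.
Variables (n : nat) (M N : lmodType F2) (f : {linear M -> N}).
Implicit Types (t : {ffun 'I_n -> M}).

Definition ffmap t : {ffun 'I_n -> N} := [ffun k => f (t k)].

Fact ffmap_upd t i x : ffmap (upd t i x) = upd (ffmap t) i (f x).
Proof. by apply/ffunP => k; rewrite !ffunE; case: ifP. Qed.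

Fact ext_map_lin t i : linear (fun x => wedge (ffmap (upd t i x))).
Proof. by move=> a x y; rewrite !ffmap_upd linearP wedge_lin. Qed.
Fact ext_map_alt t (i j : 'I_n) :
  i != j -> t i = t j -> wedge (ffmap t) = 0.
Proof. by move=> ij tij; apply: (wedge_alt ij); rewrite !ffunE tij. Qed.

Definition ext_map : {linear extpow n M -> extpow n N} :=
  ext_lift ext_map_lin ext_map_alt.
Fact ext_mapE t : ext_map (wedge t) = wedge (ffmap t).
Proof. exact: ext_liftE. Qed.
End ExteriorMap.
Global Opaque ext_map.

Section SmallWedges.
Variable M : lmodType F2.

Definition wedge2 (x y : M) : extpow 2 M :=
  wedge [ffun i : 'I_2 => nth 0 [:: x; y] i].
Definition wedge3 (x y z : M) : extpow 3 M :=
  wedge [ffun i : 'I_3 => nth 0 [:: x; y; z] i].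

Fact wedge2_linl y : linear (wedge2^~ y).
Proof.
move=> a x x'.
have E z : wedge2 z y = wedge (upd [ffun i : 'I_2 => nth 0 [:: 0; y] i] ord0 z).
  by congr wedge; apply/ffunP => -[[|[|//]] Hi]; rewrite !ffunE.
by rewrite !E wedge_lin.
Qed.
Fact wedge2_linr x : linear (wedge2 x).
Proof.
move=> a y y'.
have E z : wedge2 x z = wedge (upd [ffun i : 'I_2 => nth 0 [:: x; 0] i] ord_max z).
  by congr wedge; apply/ffunP => -[[|[|//]] Hi]; rewrite !ffunE.
by rewrite !E wedge_lin.
Qed.
Definition wedge2l y : {linear M -> extpow 2 M} := mklin (wedge2_linl y).
Definition wedge2r x : {linear M -> extpow 2 M} := mklin (wedge2_linr x).

Fact wedge2_alt x : wedge2 x x = 0.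
Proof. by apply: (@wedge_alt _ _ _ ord0 ord_max); rewrite ?ffunE. Qed.

Fact wedge2Dl x x' y : wedge2 (x + x') y = wedge2 x y + wedge2 x' y.
Proof. exact: (linearD (wedge2l y)). Qed.
Fact wedge2Dr x y y' : wedge2 x (y + y') = wedge2 x y + wedge2 x y'.
Proof. exact: (linearD (wedge2r x)). Qed.
Fact wedge2_0l y : wedge2 0 y = 0.
Proof. exact: (linear0 (wedge2l y)). Qed.

Fact wedge2_sym x y : wedge2 x y = wedge2 y x.
Proof.
have := wedge2_alt (x + y).
rewrite wedge2Dl !wedge2Dr !wedge2_alt add0r addr0 => /eqP.
by rewrite addr_eq0 oppv => /eqP.
Qed.

Fact wedge3_lin x y : linear (wedge3 x y).
Proof.
move=> a z z'.
have E s : wedge3 x y s = wedge (upd [ffun i : 'I_3 => nth 0 [:: x; y; 0] i] ord_max s).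
  by congr wedge; apply/ffunP => -[[|[|[|//]]] Hi]; rewrite !ffunE.
by rewrite !E wedge_lin.
Qed.
Definition wedge3r x y : {linear M -> extpow 3 M} := mklin (wedge3_lin x y).

Fact wedge3_linm x z : linear (fun y => wedge3 x y z).
Proof.
move=> a y y'.
have E s : wedge3 x s z = wedge (upd [ffun i : 'I_3 => nth 0 [:: x; 0; z] i] (inord 1) s).
  congr wedge; apply/ffunP => i; rewrite !ffunE -val_eqE /= inordK //.
  by case: i => -[|[|[|//]]].
by rewrite !E wedge_lin.
Qed.
Fact wedge3_linl y z : linear (fun x => wedge3 x y z).
Proof.
move=> a x x'.
have E s : wedge3 s y z = wedge (upd [ffun i : 'I_3 => nth 0 [:: 0; y; z] i] ord0 s).
  by congr wedge; apply/ffunP => -[[|[|[|//]]] Hi]; rewrite !ffunE.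
by rewrite !E wedge_lin.
Qed.
Fact wedge3_alt x z : wedge3 x x z = 0.
Proof. by apply: (@wedge_alt _ _ _ ord0 (inord 1)); rewrite -?val_eqE ?ffunE /= inordK. Qed.

Fact wedge3Dm x y y' z : wedge3 x (y + y') z = wedge3 x y z + wedge3 x y' z.
Proof. exact: (linearD (mklin (wedge3_linm x z))). Qed.
Fact wedge3Dl x x' y z : wedge3 (x + x') y z = wedge3 x y z + wedge3 x' y z.
Proof. exact: (linearD (mklin (wedge3_linl y z))). Qed.

Fact wedge3_sym x y z : wedge3 x y z = wedge3 y x z.
Proof.
have := wedge3_alt (x + y) z.
rewrite wedge3Dl !wedge3Dm !wedge3_alt add0r addr0 => /eqP.
by rewrite addr_eq0 oppv => /eqP.
Qed.
End SmallWedges.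

Fact ext_map_wedge2 (M N : lmodType F2) (f : {linear M -> N}) x y :
  ext_map 2 f (wedge2 x y) = wedge2 (f x) (f y).
Proof.
rewrite /wedge2 ext_mapE; congr wedge; apply/ffunP => -[[|[|//]] Hi];
by rewrite !ffunE.
Qed.
Fact ext_map_wedge3 (M N : lmodType F2) (f : {linear M -> N}) x y z :
  ext_map 3 f (wedge3 x y z) = wedge3 (f x) (f y) (f z).
Proof.
rewrite /wedge3 ext_mapE; congr wedge; apply/ffunP => -[[|[|[|//]]] Hi];
by rewrite !ffunE.
Qed.

Fact ext_map_id n (M : lmodType F2) (f : {linear M -> M}) :
  f =1 id -> ext_map n f =1 id.
Proof.
move=> f1; apply: (ext_ext (g := idfun)) => t; rewrite ext_mapE /=.
by congr wedge; apply/ffunP => k; rewrite ffunE f1.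
Qed.
Fact ext_map_comp n (M N P : lmodType F2) (f : {linear M -> N})
    (g : {linear N -> P}) (h : {linear M -> P}) :
  h =1 g \o f -> ext_map n h =1 ext_map n g \o ext_map n f.
Proof.
move=> hgf; apply: (ext_ext (g := ext_map n g \o ext_map n f)) => t.
rewrite /= !ext_mapE; congr wedge; apply/ffunP => k.
by rewrite !ffunE hgf.
Qed.
Fact tens_map_id (M N : lmodType F2) (f : {linear M -> M}) (g : {linear N -> N}) :
  f =1 id -> g =1 id -> tens_map f g =1 id.
Proof.
by move=> f1 g1; apply: (tens_ext (g := idfun)) => x y; rewrite tens_mapE f1 g1.
Qed.
Fact tens_map_comp (M M' M'' N N' N'' : lmodType F2)
    (f : {linear M -> M'}) (f' : {linear M' -> M''}) (f'' : {linear M -> M''})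
    (g : {linear N -> N'}) (g' : {linear N' -> N''}) (g'' : {linear N -> N''}) :
  f'' =1 f' \o f -> g'' =1 g' \o g ->
  tens_map f'' g'' =1 tens_map f' g' \o tens_map f g.
Proof.
move=> ff gg; apply: (tens_ext (g := tens_map f' g' \o tens_map f g)) => x y.
by rewrite /= !tens_mapE ff gg.
Qed.

Section Pbar.
Variable M : lmodType F2.

Inductive zero_rel : {freeg M / F2} -> Prop := Zero_rel : zero_rel << 0 >>.

(* F_2[M] / F_2 [0]; [br u] is the class of [u]. *)
Definition pbar : lmodType F2 := pres zero_rel.
Definition br (u : M) : pbar := pgen zero_rel u.

Fact br0 : br 0 = 0. Proof. exact: (gen_rel Zero_rel). Qed.

Fact zero_compat (W : lmodType F2) (f : M -> W) : f 0 = 0 -> compat zero_rel f.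
Proof. by move=> f0 r []; rewrite free_liftE. Qed.

Definition pbar_lift (W : lmodType F2) (f : M -> W) (f0 : f 0 = 0) :
  {linear pbar -> W} := pres_lift (zero_compat f0).
Fact pbar_liftE (W : lmodType F2) (f : M -> W) (f0 : f 0 = 0) u :
  pbar_lift f0 (br u) = f u.
Proof. exact: pres_liftE. Qed.

Fact pbar_ext (W : lmodType F2) (f g : {linear pbar -> W}) :
  (forall u, f (br u) = g (br u)) -> f =1 g.
Proof. exact: pres_ext. Qed.

Fact pbar_ind (P : pbar -> Prop) :
  P 0 -> (forall a u x, P x -> P (a *: br u + x)) -> forall x, P x.
Proof.
move=> P0 PD q; rewrite -[q]qreprK; move: (qrepr q) => r {q}.
elim/freeg_ind_dom0: r => [|k x D _ _ IH]; first by rewrite proj0.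
have -> : << k *g x >> = k *: << x >> :> {freeg M / F2}.
  by apply/eqP/freeg_eqP => y; rewrite coeffZ !coeffU mul1r.
by rewrite projD proj_scale; apply: PD.
Qed.

Fact pbar2_ext (W : lmodType F2) (f g : {linear extpow 2 pbar -> W}) :
  (forall u v, f (wedge2 (br u) (br v)) = g (wedge2 (br u) (br v))) -> f =1 g.
Proof.
move=> fg; apply: ext_ext => t.
have -> : wedge t = wedge2 (t ord0) (t ord_max).
  congr wedge; apply/ffunP => -[[|[|//]] Hi]; rewrite ffunE /=;
  congr (t _); exact: val_inj.
move: (t ord0) (t ord_max) => p q.
rewrite -[LHS]/((f \o wedge2l q : {linear _ -> _}) p).
rewrite -[RHS]/((g \o wedge2l q : {linear _ -> _}) p).
apply: pbar_ext => u /=.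
rewrite -[LHS]/((f \o wedge2r (br u) : {linear _ -> _}) q).
rewrite -[RHS]/((g \o wedge2r (br u) : {linear _ -> _}) q).
by apply: pbar_ext => v /=.
Qed.

(* Linear maps out of the second exterior power of [pbar] are given by their
   values [b u v] on [u] /\ [v]: bilinearity is automatic, as the classes
   [br u], u <> 0, form a basis of [pbar]. *)
Section Pbar2Lift.
Variables (W : lmodType F2) (b : M -> M -> W).
Hypotheses (b_alt : forall u, b u u = 0) (b_sym : forall u v, b u v = b v u).
Hypothesis b0 : forall v, b 0 v = 0.

Fact pbar2_b0 u : b u 0 = 0. Proof. by rewrite b_sym b0. Qed.

Definition pbar2_b1 (q : pbar) (u : M) : W := pbar_lift (pbar2_b0 u) q.
Fact pbar2_b1_0 q : pbar2_b1 q 0 = 0.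
Proof. by move: q; apply: (pbar_ext (g := \0)) => v; rewrite pbar_liftE b0. Qed.
Definition pbar2_bil (p q : pbar) : W := pbar_lift (pbar2_b1_0 q) p.

Fact pbar2_bilE u v : pbar2_bil (br u) (br v) = b u v.
Proof. by rewrite /pbar2_bil pbar_liftE /pbar2_b1 pbar_liftE. Qed.

Fact pbar2_linl q : linear (pbar2_bil^~ q).
Proof. by move=> a p p'; rewrite /pbar2_bil linearP. Qed.
Fact pbar2_linr p : linear (pbar2_bil p).
Proof.
move=> a q q'; rewrite /pbar2_bil; move: p.
apply: (pbar_ext (g := (a \*: pbar_lift (pbar2_b1_0 q))
  \+ pbar_lift (pbar2_b1_0 q'))) => u /=.
by rewrite !pbar_liftE /pbar2_b1 linearP.
Qed.

Fact pbar2_sym p q : pbar2_bil p q = pbar2_bil q p.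
Proof.
rewrite -[LHS]/(mklin (pbar2_linl q) p) -[RHS]/(mklin (pbar2_linr q) p).
apply: pbar_ext => u /=.
rewrite -[LHS]/(mklin (pbar2_linr (br u)) q).
rewrite -[RHS]/(mklin (pbar2_linl (br u)) q).
by apply: pbar_ext => v /=; rewrite !pbar2_bilE b_sym.
Qed.
Fact pbar2_alt p : pbar2_bil p p = 0.
Proof.
elim/pbar_ind: p => [|a u p IH]; first exact: (linear0 (mklin (pbar2_linr 0))).
rewrite pbar2_linr !pbar2_linl IH pbar2_bilE b_alt scaler0 add0r addr0.
by rewrite (pbar2_sym p) addvv.
Qed.

Definition pbar2_fun (t : {ffun 'I_2 -> pbar}) : W :=
  pbar2_bil (t ord0) (t ord_max).
Fact pbar2_fun_lin t i : linear (fun x => pbar2_fun (upd t i x)).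
Proof.
move=> a x y; rewrite /pbar2_fun !ffunE.
by case: i => -[|[|//]] Hi /=; rewrite ?pbar2_linl ?pbar2_linr.
Qed.
Fact pbar2_fun_alt (t : {ffun 'I_2 -> pbar}) (i j : 'I_2) :
  i != j -> t i = t j -> pbar2_fun t = 0.
Proof.
move=> ij tij; have t01 : t ord0 = t ord_max.
  case: i j ij tij => -[|[|//]] Hi [] [|[|//]] Hj //= _;
  by [rewrite (_ : Ordinal Hi = ord0) 1?(_ : Ordinal Hj = ord_max) //;
      exact: val_inj
     |rewrite (_ : Ordinal Hj = ord0) 1?(_ : Ordinal Hi = ord_max) //;
      exact: val_inj].
by rewrite /pbar2_fun t01 pbar2_alt.
Qed.

Definition pbar2_lift : {linear extpow 2 pbar -> W} :=
  ext_lift pbar2_fun_lin pbar2_fun_alt.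
Fact pbar2_liftE u v : pbar2_lift (wedge2 (br u) (br v)) = b u v.
Proof. by rewrite ext_liftE /pbar2_fun !ffunE pbar2_bilE. Qed.
End Pbar2Lift.

Definition Pi_bil (u v : M) : extpow 2 pbar := wedge2 (br u + br v) (br (u + v)).
Fact Pi_bil_alt u : Pi_bil u u = 0.
Proof. by rewrite /Pi_bil addvv wedge2_0l. Qed.
Fact Pi_bil_sym u v : Pi_bil u v = Pi_bil v u.
Proof. by rewrite /Pi_bil (addrC u) (addrC (br u)). Qed.
Fact Pi_bil_0 v : Pi_bil 0 v = 0.
Proof. by rewrite /Pi_bil br0 !add0r wedge2_alt. Qed.
Definition Pi_lin : {linear extpow 2 pbar -> extpow 2 pbar} :=
  pbar2_lift Pi_bil_alt Pi_bil_sym Pi_bil_0.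

(* The formula for u, v nonzero; it remains valid for all u and v. *)
Fact Pi_linE u v :
  Pi_lin (wedge2 (br u) (br v)) = wedge2 (br u + br v) (br (u + v)).
Proof. exact: pbar2_liftE. Qed.

Fact Pi_lin_idem x : Pi_lin (Pi_lin x) = Pi_lin x.
Proof.
move: x; apply: (pbar2_ext (f := Pi_lin \o Pi_lin)) => u v /=.
rewrite !Pi_linE !wedge2Dl linearD !Pi_linE.
have -> : u + (u + v) = v by rewrite addrA addvv add0r.
have -> : v + (u + v) = u by rewrite addrCA addvv addr0.
rewrite !wedge2Dl (wedge2_sym (br v) (br u)) addrACA addvv add0r addrC.
by rewrite !(wedge2_sym (br (u + v))).
Qed.

Section G.
Variable n : nat.

Definition g_bil (y : extpow n M) (u v : M) : tensor (extpow 2 pbar) (extpow n (extpow 3 M)) :=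
  tens (wedge2 (br u) (br v)) (ext_map n (wedge3r u v) y).

Fact g_bil_alt y u : g_bil y u u = 0.
Proof. by rewrite /g_bil wedge2_alt tens0l. Qed.
Fact g_bil_sym y u v : g_bil y u v = g_bil y v u.
Proof.
rewrite /g_bil wedge2_sym; congr (tens _ (ext_map n _ y)).
by apply: lin_ext => a; apply: wedge3_sym.
Qed.
Fact g_bil_0 y v : g_bil y 0 v = 0.
Proof. by rewrite /g_bil br0 wedge2_0l tens0l. Qed.

Definition g_fun (x : extpow 2 pbar) (y : extpow n M) :
    tensor (extpow 2 pbar) (extpow n (extpow 3 M)) :=
  pbar2_lift (g_bil_alt y) (g_bil_sym y) (g_bil_0 y) x.

Fact g_fun_linl y : linear (g_fun^~ y).
Proof. by move=> a x x'; rewrite /g_fun linearP. Qed.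
Fact g_fun_linr x : linear (g_fun x).
Proof.
move=> a y y'; rewrite /g_fun; move: x.
pose L y := pbar2_lift (g_bil_alt y) (g_bil_sym y) (g_bil_0 y).
apply: (pbar2_ext (g := (a \*: L y) \+ L y')) => u v /=.
by rewrite !pbar2_liftE /g_bil linearP tens_is_linearr.
Qed.

Definition g_lin : {linear tensor (extpow 2 pbar) (extpow n M) ->
                           tensor (extpow 2 pbar) (extpow n (extpow 3 M))} :=
  tens_lift g_fun_linl g_fun_linr.

Fact g_linE u v (a : {ffun 'I_n -> M}) :
  g_lin (tens (wedge2 (br u) (br v)) (wedge a))
  = tens (wedge2 (br u) (br v)) (wedge [ffun i => wedge3 u v (a i)]).
Proof. by rewrite tens_liftE /g_fun pbar2_liftE /g_bil ext_mapE. Qed.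

Fact g_ext (W : lmodType F2) (f h : {linear tensor (extpow 2 pbar) (extpow n M) -> W}) :
  (forall u v a, f (tens (wedge2 (br u) (br v)) (wedge a))
               = h (tens (wedge2 (br u) (br v)) (wedge a))) -> f =1 h.
Proof.
move=> fh; apply: tens_ext => x y.
rewrite -[LHS]/((f \o tensl _ y : {linear _ -> _}) x).
rewrite -[RHS]/((h \o tensl _ y : {linear _ -> _}) x).
apply: pbar2_ext => u v /=.
rewrite -[LHS]/((f \o tensr _ _ : {linear _ -> _}) y).
rewrite -[RHS]/((h \o tensr _ _ : {linear _ -> _}) y).
by apply: ext_ext => a /=.
Qed.

Fact g_Pi x :
  g_lin (tens_map Pi_lin (idfun : {linear extpow n M -> extpow n M}) x)
  = tens_map Pi_lin (idfun : {linear extpow n (extpow 3 M) -> extpow n (extpow 3 M)})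
      (g_lin x).
Proof.
move: x; apply: (g_ext (f := g_lin \o tens_map Pi_lin idfun)
                       (h := tens_map Pi_lin idfun \o g_lin)) => u v a /=.
have E w : wedge3 u (u + v) w = wedge3 u v w by rewrite wedge3Dm wedge3_alt add0r.
have E' w : wedge3 v (u + v) w = wedge3 u v w.
  by rewrite wedge3Dm wedge3_alt addr0 wedge3_sym.
have Ea : [ffun i => wedge3 u (u + v) (a i)] = [ffun i => wedge3 u v (a i)].
  by apply/ffunP => i; rewrite !ffunE E.
have Ea' : [ffun i => wedge3 v (u + v) (a i)] = [ffun i => wedge3 u v (a i)].
  by apply/ffunP => i; rewrite !ffunE E'.
by rewrite g_linE !tens_mapE /= Pi_linE !wedge2Dl !tensDl linearD !g_linE Ea Ea'.
Qed.
End G.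

End Pbar.
Global Opaque pbar br pbar_lift pbar2_lift Pi_lin g_lin.

#[local] Obligation Tactic := idtac.

(* Functors from finite-dimensional F_2-vector spaces ([vectType], with linear
   maps ['Hom(V, W)]) to all F_2-vector spaces. *)
Record functor := Functor {
  fobj :> vectType F2 -> lmodType F2;
  fmap : forall V W : vectType F2, 'Hom(V, W) -> {linear fobj V -> fobj W};
  fmap_id : forall (V : vectType F2) x, fmap (\1%VF : 'Hom(V, V)) x = x;
  fmap_comp : forall (U V W : vectType F2) (f : 'Hom(U, V)) (g : 'Hom(V, W)) x,
    fmap (g \o f)%VF x = fmap g (fmap f x)
}.
Arguments fmap F {V W} f : rename.

Record nattrans (F G : functor) := Nattrans {
  ntapp :> forall V : vectType F2, {linear F V -> G V};
  ntappE : forall (V W : vectType F2) (f : 'Hom(V, W)) x,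
    ntapp W (fmap F f x) = fmap G f (ntapp V x)
}.

Section Nattrans.
Variables F G H : functor.

Program Definition nt_id : nattrans F F :=
  @Nattrans F F (fun V => idfun : {linear F V -> F V}) _.
Next Obligation. by []. Qed.

Program Definition nt_comp (b : nattrans G H) (a : nattrans F G) : nattrans F H :=
  @Nattrans F H (fun V => (b V \o a V : F V -> H V) : {linear F V -> H V}) _.
Next Obligation. by move=> b a V W f x; rewrite /= !ntappE. Qed.

Program Definition nt_sub (a b : nattrans F G) : nattrans F G :=
  @Nattrans F G (fun V => (a V \- b V : F V -> G V) : {linear F V -> G V}) _.
Next Obligation. by move=> a b V W f x; rewrite /= !ntappE linearB. Qed.
End Nattrans.

Record subfunctor (F : functor) := Subfunctor {
  subf :> forall V : vectType F2, submodClosed (F V);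
  subf_stable : forall (V W : vectType F2) (f : 'Hom(V, W)) x,
    x \in subf V -> fmap F f x \in subf W
}.

Section SubfunctorObject.
Variables (F : functor) (S : subfunctor F).

Section Map.
Variables (V W : vectType F2) (f : 'Hom(V, W)).
Definition subf_map_fun (x : subspace (S V)) : subspace (S W) :=
  Subspace (subf_stable f (subvalP x)).
Fact subf_map_linear : linear subf_map_fun.
Proof. by move=> a x y; apply: subspace_ext; rewrite /= linearP. Qed.
Definition subf_map := mklin subf_map_linear.
End Map.

Program Definition subf_obj : functor :=
  @Functor (fun V => subspace (S V) : lmodType F2) subf_map _ _.
Next Obligation. by move=> V x; apply: subspace_ext; apply: fmap_id. Qed.
Next Obligation. by move=> U V W f g x; apply: subspace_ext; apply: fmap_comp. Qed.

Program Definition subf_incl : nattrans subf_obj F :=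
  @Nattrans subf_obj F (fun V => subval_lin (S V)) _.
Next Obligation. by []. Qed.

Section Corestriction.
Variables (G : functor) (a : nattrans G F).
Hypothesis aS : forall (V : vectType F2) (x : G V), a V x \in S V.

Fact corestr_linear (V : vectType F2) : linear (fun x => Subspace (@aS V x)).
Proof. by move=> k x y; apply: subspace_ext; rewrite /= linearP. Qed.
Program Definition corestr : nattrans G subf_obj :=
  @Nattrans G subf_obj (fun V => mklin (@corestr_linear V)) _.
Next Obligation. by move=> V W f x; apply: subspace_ext; rewrite /= ntappE. Qed.
End Corestriction.
End SubfunctorObject.

Section KernelImage.
Variables (F G : functor) (a : nattrans F G).

Section At.
Variable V : vectType F2.
Definition ker_pred : {pred F V} := fun x => a V x == 0.
Definition im_pred : {pred G V} := fun y => `[< exists x, a V x = y >].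
Fact ker_closed : submod_closed ker_pred.
Proof.
split=> [|k x y /eqP x0 /eqP y0]; apply/eqP; first exact: linear0.
by rewrite linearP x0 y0 scaler0 addr0.
Qed.
Fact im_closed : submod_closed im_pred.
Proof.
split=> [|k x y /asboolP [x' <-] /asboolP [y' <-]]; apply/asboolP.
  by exists 0; rewrite linear0.
by exists (k *: x' + y'); rewrite linearP.
Qed.
HB.instance Definition _ := GRing.isSubmodClosed.Build F2 (F V) ker_pred ker_closed.
HB.instance Definition _ := GRing.isSubmodClosed.Build F2 (G V) im_pred im_closed.
End At.

Program Definition nt_ker : subfunctor F :=
  @Subfunctor F (fun V => ker_pred (V := V)) _.
Next Obligation.
by move=> V W f x /eqP x0; apply/eqP; rewrite ntappE x0 linear0.
Qed.
Program Definition nt_im : subfunctor G :=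
  @Subfunctor G (fun V => im_pred (V := V)) _.
Next Obligation.
by move=> V W f _ /asboolP [x <-]; apply/asboolP; exists (fmap F f x); rewrite ntappE.
Qed.

Fact nt_imP V x : a V x \in nt_im V.
Proof. by apply/asboolP; exists x. Qed.
End KernelImage.

Definition mono (F G : functor) (a : nattrans F G) : Prop :=
  forall (H : functor) (b c : nattrans H F),
    (forall V x, nt_comp a b V x = nt_comp a c V x) ->
    forall V x, b V x = c V x.

Record subobject (F : functor) := Subobject {
  so_src : functor;
  so_arr : nattrans so_src F;
  so_mono : mono so_arr
}.

Definition so_le (F : functor) (A B : subobject F) : Prop :=
  exists h : nattrans (so_src A) (so_src B),
    forall V x, nt_comp (so_arr B) h V x = so_arr A V x.

Definition so_equiv (F : functor) (A B : subobject F) : Prop :=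
  so_le A B /\ so_le B A.

Definition artinian (F : functor) : Prop :=
  forall S : nat -> subobject F,
    (forall n, so_le (S n.+1) (S n)) ->
    exists N, forall n, (N <= n)%N -> so_equiv (S n) (S N).

Fact mono_inj (F G : functor) (a : nattrans F G) :
  mono a -> forall V x y, a V x = a V y -> x = y.
Proof.
move=> am V x y axy; pose K := nt_ker a; pose i := subf_incl K.
have Kxy : x - y \in K V by apply/eqP; rewrite linearB axy subrr.
apply/eqP; rewrite -subr_eq0; apply/eqP.
have := am _ i (nt_sub i i) _ V (Subspace Kxy); rewrite /= subrr; apply.
by move=> W [z /eqP z0] /=; rewrite subrr linear0.
Qed.

Fact subf_incl_mono (F : functor) (S : subfunctor F) : mono (subf_incl S).
Proof. by move=> H b c bc V x; apply: subspace_ext; apply: bc. Qed.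

Section Factor.
Variables (F : functor) (A B : subobject F).
Hypothesis AB : forall V : vectType F2,
  {subset nt_im (so_arr A) V <= nt_im (so_arr B) V}.

Fact factor_ex (V : vectType F2) (x : so_src A V) :
  exists y, so_arr B V y = so_arr A V x.
Proof. by apply/asboolP/AB/nt_imP. Qed.

Definition factor_fun (V : vectType F2) (x : so_src A V) : so_src B V :=
  projT1 (cid (factor_ex x)).
Fact factor_funE (V : vectType F2) (x : so_src A V) :
  so_arr B V (factor_fun x) = so_arr A V x.
Proof. exact: projT2 (cid (factor_ex x)). Qed.

Fact factor_linear V : linear (@factor_fun V).
Proof.
move=> a x y; apply: (mono_inj (@so_mono _ B)).
by rewrite linearP !factor_funE linearP.
Qed.

Fact so_le_im : so_le A B.
Proof.
have nat_f (V W : vectType F2) (f : 'Hom(V, W)) x :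
    mklin (@factor_linear W) (fmap (so_src A) f x)
    = fmap (so_src B) f (mklin (@factor_linear V) x).
  apply: (mono_inj (@so_mono _ B)).
  by rewrite ntappE /= !factor_funE ntappE.
by exists (Nattrans nat_f) => V x /=; rewrite factor_funE.
Qed.
End Factor.

(* Monomorphisms of functors are the pointwise injective ones, so that
   subobjects may be replaced with subfunctors. *)
Lemma artinianP (F : functor) :
  artinian F <->
  forall S : nat -> subfunctor F,
    (forall n V, {subset S n.+1 V <= S n V}) ->
    exists N, forall n, (N <= n)%N -> forall V, S n V =i S N V.
Proof.
have leP (A B : subobject F) : so_le A B ->
    forall V : vectType F2, {subset nt_im (so_arr A) V <= nt_im (so_arr B) V}.
  by move=> [h hE] V _ /asboolP [x <-]; rewrite -hE; apply: nt_imP.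
have imE (S : subfunctor F) V : nt_im (subf_incl S) V =i S V.
  move=> x; apply/asboolP/idP => [[[y Sy] <-] //|Sx].
  by exists (Subspace Sx).
split=> [aF S dS|aF S dS].
  have [|N NP] := aF (fun n => Subobject (@subf_incl_mono F (S n))).
    by move=> n; apply: so_le_im => V x; rewrite /= !imE; apply: dS.
  exists N => n /NP [/leP le1 /leP le2] V x.
  apply/idP/idP => Sx.
    by have := le1 V x; rewrite /= !imE; apply.
  by have := le2 V x; rewrite /= !imE; apply.
have [|N NP] := aF (fun n => nt_im (so_arr (S n))).
  by move=> n V; apply: leP (dS n) V.
exists N => n /NP E; split; apply: so_le_im => V x; first by rewrite E.
by rewrite -E.
Qed.

Program Definition idF : functor :=
  @Functor (fun V => V : lmodType F2) (fun V W f => f : {linear V -> W}) _ _.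
Next Obligation. by move=> V x; rewrite /= id_lfunE. Qed.
Next Obligation. by move=> U V W f g x; rewrite /= comp_lfunE. Qed.

Program Definition extF n (F : functor) : functor :=
  @Functor (fun V => extpow n (F V)) (fun V W f => ext_map n (fmap F f)) _ _.
Next Obligation. by move=> n F V x; apply: ext_map_id; apply: fmap_id. Qed.
Next Obligation.
by move=> n F U V W f g x; apply: ext_map_comp => y; apply: fmap_comp.
Qed.

Program Definition tensF (F G : functor) : functor :=
  @Functor (fun V => tensor (F V) (G V))
    (fun V W f => tens_map (fmap F f) (fmap G f)) _ _.
Next Obligation. by move=> F G V x; apply: tens_map_id => y; apply: fmap_id. Qed.
Next Obligation.
by move=> F G U V W f g x; apply: tens_map_comp => y; apply: fmap_comp.
Qed.

Program Definition nt_tens (F F' G G' : functor) (a : nattrans F F')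
    (b : nattrans G G') : nattrans (tensF F G) (tensF F' G') :=
  @Nattrans (tensF F G) (tensF F' G') (fun V => tens_map (a V) (b V)) _.
Next Obligation.
move=> F F' G G' a b V W f.
apply: (tens_ext (f := tens_map (a W) (b W) \o tens_map (fmap F f) (fmap G f))
  (g := tens_map (fmap F' f) (fmap G' f) \o tens_map (a V) (b V))) => x y.
by rewrite /= !tens_mapE !ntappE.
Qed.

Definition vdual (V : vectType F2) : vectType F2 := 'Hom(V, F2^o).

Section Transpose.
Variables (V W : vectType F2) (f : 'Hom(V, W)).
Fact vdual_map_linear : linear (fun u : vdual W => (u \o f)%VF : vdual V).
Proof. by move=> a u v; rewrite comp_lfunDl comp_lfunZl. Qed.
Definition vdual_map : 'Hom(vdual W, vdual V) := linfun (mklin vdual_map_linear).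
Fact vdual_mapE u : vdual_map u = (u \o f)%VF.
Proof. by rewrite lfunE. Qed.
End Transpose.

Program Definition dualF (F : functor) : functor :=
  @Functor (fun V => ldual (F (vdual V)))
    (fun V W f => dual_map (fmap F (vdual_map f))) _ _.
Next Obligation.
move=> F V x; apply: lin_ext => y /=.
rewrite (_ : vdual_map _ = \1%VF) ?fmap_id //.
by apply/lfunP => u; rewrite vdual_mapE comp_lfun1r id_lfunE.
Qed.
Next Obligation.
move=> F U V W f g x; apply: lin_ext => y /=.
rewrite (_ : vdual_map _ = (vdual_map f \o vdual_map g)%VF) ?fmap_comp //.
by apply/lfunP => u; rewrite comp_lfunE !vdual_mapE comp_lfunA.
Qed.

Program Definition nt_dual (F G : functor) (a : nattrans F G) :
    nattrans (dualF G) (dualF F) :=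
  @Nattrans (dualF G) (dualF F) (fun V => dual_map (a (vdual V))) _.
Next Obligation.
by move=> F G a V W f x; apply: lin_ext => y /=; rewrite ntappE.
Qed.

Section PbarMap.
Variables (M N : lmodType F2) (f : {linear M -> N}).
Fact pbar_map0 : br (f 0) = 0. Proof. by rewrite linear0 br0. Qed.
Definition pbar_map : {linear pbar M -> pbar N} :=
  pbar_lift (f := fun u => br (f u)) pbar_map0.
Fact pbar_mapE u : pbar_map (br u) = br (f u).
Proof. exact: pbar_liftE. Qed.
End PbarMap.
Global Opaque pbar_map.

Program Definition Pbar : functor :=
  @Functor (fun V => pbar V)
    (fun V W f => pbar_map (f : {linear V -> W})) _ _.
Next Obligation.
move=> V; apply: (pbar_ext (g := idfun)) => u.
by rewrite pbar_mapE /= id_lfunE.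
Qed.
Next Obligation.
move=> U V W f g.
apply: (pbar_ext (g := pbar_map (g : {linear V -> W})
                       \o pbar_map (f : {linear U -> V}))) => u.
by rewrite /= !pbar_mapE /= comp_lfunE.
Qed.

Definition Lambda n : functor := extF n idF.

Fact ext_pbar_map (M N : lmodType F2) (f : {linear M -> N}) u v :
  ext_map 2 (pbar_map f) (wedge2 (br u) (br v)) = wedge2 (br (f u)) (br (f v)).
Proof. by rewrite ext_map_wedge2 !pbar_mapE. Qed.

Program Definition Pi : nattrans (extF 2 Pbar) (extF 2 Pbar) :=
  @Nattrans (extF 2 Pbar) (extF 2 Pbar) (fun V => Pi_lin V) _.
Next Obligation.
move=> V W f; pose h := ext_map 2 (pbar_map (f : {linear V -> W})).
apply: (pbar2_ext (f := Pi_lin W \o h) (g := h \o Pi_lin V)) => u v.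
by rewrite /= ext_pbar_map !Pi_linE ext_map_wedge2 linearD !pbar_mapE linearD.
Qed.

Definition P_21_sub : subfunctor (extF 2 Pbar) := nt_im Pi.
Definition Gbar_2_sub : subfunctor (extF 2 Pbar) := nt_ker Pi.
Definition P_21 : functor := subf_obj P_21_sub.
Definition Gbar_2 : functor := subf_obj Gbar_2_sub.
Definition L_2 : functor := dualF P_21.
Definition Dbar_2 : functor := dualF Gbar_2.

Fact Pi_compl_ker V x : nt_sub (nt_id _) Pi V x \in Gbar_2_sub V.
Proof. by apply/eqP; rewrite /= linearB Pi_lin_idem subrr. Qed.

Definition projP : nattrans (extF 2 Pbar) P_21 := corestr (nt_imP Pi).
Definition projG : nattrans (extF 2 Pbar) Gbar_2 := corestr Pi_compl_ker.

Program Definition gmor n : nattrans (tensF (extF 2 Pbar) (Lambda n))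
                          (tensF (extF 2 Pbar) (extF n (Lambda 3))) :=
  @Nattrans (tensF (extF 2 Pbar) (Lambda n))
    (tensF (extF 2 Pbar) (extF n (Lambda 3))) (fun V => g_lin V n) _.
Next Obligation.
move=> n V W f; pose h := ext_map 2 (pbar_map (f : {linear V -> W})).
pose k := ext_map n (f : {linear V -> W}).
pose l := ext_map n (ext_map 3 (f : {linear V -> W})).
apply: (g_ext (f := g_lin W n \o tens_map h k) (h := tens_map h l \o g_lin V n)) => u v a.
have E : ffmap (ext_map 3 (f : {linear V -> W})) [ffun i => wedge3 u v (a i)]
         = [ffun i => wedge3 (f u) (f v) (ffmap (f : {linear V -> W}) a i)].
  by apply/ffunP => i; rewrite !ffunE ext_map_wedge3.
by rewrite /= g_linE !tens_mapE ext_pbar_map !ext_mapE g_linE E.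
Qed.

(* The diagonal components of [gmor n] for the decomposition of
   [extF 2 Pbar] into [P_21] and [Gbar_2]. Since [gmor n] commutes with [Pi]
   they are its restrictions, see [gL_incl] and [gD_incl]. *)
Definition gL n : nattrans (tensF P_21 (Lambda n)) (tensF P_21 (extF n (Lambda 3))) :=
  nt_comp (nt_tens projP (nt_id _))
    (nt_comp (gmor n) (nt_tens (subf_incl P_21_sub) (nt_id _))).
Definition gD n : nattrans (tensF Gbar_2 (Lambda n)) (tensF Gbar_2 (extF n (Lambda 3))) :=
  nt_comp (nt_tens projG (nt_id _))
    (nt_comp (gmor n) (nt_tens (subf_incl Gbar_2_sub) (nt_id _))).

Fact gmor_Pi n V x :
  gmor n V (nt_tens Pi (nt_id (Lambda n)) V x)
  = nt_tens Pi (nt_id (extF n (Lambda 3))) V (gmor n V x).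
Proof. exact: g_Pi. Qed.

Section Restriction.
Variables (S : subfunctor (extF 2 Pbar)) (V : vectType F2).
Variable p : nattrans (extF 2 Pbar) (subf_obj S).
Variable e : {linear extF 2 Pbar V -> extF 2 Pbar V}.
Hypothesis pe : forall x, subf_incl S V (p V x) = e x.
Variable G : functor.

Fact restr_projE y :
  nt_tens (subf_incl S) (nt_id G) V (nt_tens p (nt_id G) V y)
  = tens_map e (idfun : {linear G V -> G V}) y.
Proof.
move: y; apply: (tens_ext (f := nt_tens (subf_incl S) (nt_id G) V
  \o nt_tens p (nt_id G) V)) => x y.
by rewrite /= !tens_mapE -pe.
Qed.

Fact restr_inclE (h : {linear extF 2 Pbar V -> extF 2 Pbar V}) :
  (forall x, h (subf_incl S V x) = subf_incl S V x) ->
  forall y, tens_map h (idfun : {linear G V -> G V})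
      (nt_tens (subf_incl S) (nt_id G) V y)
    = nt_tens (subf_incl S) (nt_id G) V y.
Proof.
move=> hS; apply: (tens_ext (f := tens_map h idfun
  \o nt_tens (subf_incl S) (nt_id G) V)) => x y.
by rewrite /= !tens_mapE; congr tens; apply: hS.
Qed.
End Restriction.

Lemma gL_incl n V x :
  nt_tens (subf_incl P_21_sub) (nt_id (extF n (Lambda 3))) V (gL n V x)
  = gmor n V (nt_tens (subf_incl P_21_sub) (nt_id (Lambda n)) V x).
Proof.
pose z := gmor n V (nt_tens (subf_incl P_21_sub) (nt_id (Lambda n)) V x).
have -> : gL n V x = nt_tens projP (nt_id _) V z by [].
have pE y : subf_incl P_21_sub V (projP V y) = Pi V y by [].
rewrite (restr_projE pE) -[LHS]/(nt_tens Pi (nt_id _) V z) /z -gmor_Pi.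
congr (gmor n V _); apply: (restr_inclE (h := Pi V)) => -[y Py].
change (Pi V y = y); case/asboolP: Py => y' <-; exact: Pi_lin_idem.
Qed.

Lemma gD_incl n V x :
  nt_tens (subf_incl Gbar_2_sub) (nt_id (extF n (Lambda 3))) V (gD n V x)
  = gmor n V (nt_tens (subf_incl Gbar_2_sub) (nt_id (Lambda n)) V x).
Proof.
pose w := nt_tens (subf_incl Gbar_2_sub) (nt_id (Lambda n)) V x.
have -> : gD n V x = nt_tens projG (nt_id _) V (gmor n V w) by [].
pose e := nt_sub (nt_id (extF 2 Pbar)) Pi.
have pE y : subf_incl Gbar_2_sub V (projG V y) = e V y by [].
have eE G (y : tensF (extF 2 Pbar) G V) :
    tens_map (e V) idfun y = y - nt_tens Pi (nt_id G) V y.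
  move: y; apply: (tens_ext (g := idfun \- nt_tens Pi (nt_id G) V)) => p q.
  by rewrite /= !tens_mapE /=; apply: (linearB (tensl _ q)).
rewrite (restr_projE pE) eE -gmor_Pi -linearB -eE; congr (gmor n V _).
apply: (restr_inclE (h := e V)) => -[y Py].
have Piy : Pi V y = 0 by apply/eqP.
by change (y - Pi V y = y); rewrite Piy subr0.
Qed.

(* The image is a subfunctor of [dualF (tensF P_21 (Lambda n))], which stands
   for the tensor product of [L_2] and [Lambda n] under the commutation of
   duality with tensor products and exterior powers; likewise for [D2n]. *)
Definition L2n n : functor :=
  if n is 0 then L_2 else subf_obj (nt_im (nt_dual (gL n))).
Definition D2n n : functor :=
  if n is 0 then Dbar_2 else subf_obj (nt_im (nt_dual (gD n))).

(* Main.v *)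
From HB Require Import structures.
From mathcomp Require Import all_boot all_algebra.
From mathcomp Require Import boolp zify.
Require Import Defs.

Set Implicit Arguments.
Unset Strict Implicit.
Unset Printing Implicit Defensive.

Import GRing.Theory VectorInternalTheory.

(** Both families consist of subfunctors of duals [dualF G], where [G] is a
    quotient of [V |-> F_2[V^I]] for a finite set [I]: [G] is a tensor product of
    a direct summand of [Lambda^2 Pbar] with [Lambda^n] (the summand alone for
    [n = 0]), and is spanned, naturally in [V], by elements attached
    to tuples of [2 + n] vectors of [V]. Artinian
    objects being closed under subobjects, it is enough to show that such a
    [dualF G] is artinian ([dual_tuple_spanned_artinian]). This is dual to
    the noetherianity of [V |-> F_2[V^I]], and the proof is the Groebner basis
    method of Sam and Snowden, carried out directly on the dual side.

    An element of [dualF G] at [F_2^m] is determined by its values on [I]-tuples of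
    linear forms on [F_2^m]. Such a tuple is an [I * m] matrix, that is, a word
    of length [m] whose letters are the columns, in the finite alphabet
    [F_2^I]; elements thus become functions on words. To a subfunctor [S] attach
    the set [leading S] of the words that are lexicographically least in the
    support of some element of [S]. Two facts hold:
    - two nested subfunctors with the same leading words are equal, by
      successive subtraction ([leading_sub]);
    - leading words stay leading when a letter that occurs earlier in the word
      is deleted ([leading_deletion]): the linear map
      [F_2^(m+1) -> F_2^m] identifying two basis vectors acts on
      functions by pulling words back along the repetition of a letter,
      and this repetition is strictly monotone for the lexicographic order.

    Sets of words closed under these deletions satisfy the descending chain
    condition ([repeat_deletion_dcc]). For if each letter of a word is
    paired with the set of letters before it, then an embedding of annotated
    words gives a sequence of deletions of repeated letters, and Higman's
    lemma provides embeddings. *)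

(** * Higman's lemma *)

Section Higman.
Variable A : finType.
Implicit Types s t : nat -> seq A.

Definition bad s := forall i j, (i < j)%N -> ~~ subseq (s i) (s j).

Definition agree n s t := forall i, (i < n)%N -> t i = s i.

Lemma infinite_fiber (h : nat -> A) :
  exists a, forall N, exists n, (N <= n)%N /\ h n = a.
Proof.
apply: contrapT => /forallNP H.
have /choice[f fP] a : exists N, forall n, (N <= n)%N -> h n <> a.
  have /existsNP[N NP] := H a; exists N => n Nn hn.
  by apply: NP; exists n.
exact: (fP (h (\max_a f a)) _ (leq_bigmax _)).
Qed.

Lemma infinite_fiber_mono (h : nat -> A) :
  exists a (k : nat -> nat),
    {homo k : i j / (i < j)%N} /\ forall i, h (k i) = a.
Proof.
have [a /choice[f fP]] := infinite_fiber h.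
pose k i := iter i (fun n => f n.+1) (f 0%N).
exists a, k; split=> [|[|i]]; [|exact: (fP _).2..].
by apply: homo_ltn => [? ? ?|i]; [apply: ltn_trans | exact: (fP _).1].
Qed.

Lemma shorten_bad n s : bad s ->
  exists t, [/\ bad t, agree n s t
    & forall t', bad t' -> agree n s t' -> (size (t n) <= size (t' n))%N].
Proof.
move=> bs; pose P k := `[< exists t, [/\ bad t, agree n s t & size (t n) = k] >].
have exP : exists k, P k by exists (size (s n)); apply/asboolP; exists s.
case: (ex_minnP exP) => k /asboolP[t [bt st <-]] kmin; exists t; split=> //.
by move=> t' bt' st'; apply: kmin; apply/asboolP; exists t'.
Qed.

(** Entry [n] of the limit is fixed at stage [n] of an iterated shortening, so
    that it has least length among the bad sequences with the same first
    [n] entries. *)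
Lemma minimal_bad s : bad s ->
  exists t, bad t /\
    forall n t', bad t' -> agree n t t' -> (size (t n) <= size (t' n))%N.
Proof.
move=> bs.
have /choice[f fP] (p : nat * (nat -> seq A)) :
    exists t, bad p.2 -> [/\ bad t, agree p.1 p.2 t
    & forall t', bad t' -> agree p.1 p.2 t' -> (size (t p.1) <= size (t' p.1))%N].
  case: (pselect (bad p.2)) => [/(shorten_bad p.1)[t tP]|]; last by exists s.
  by exists t.
pose u := fix u n := if n is m.+1 then f (m, u m) else s.
have bu n : bad (u n) by elim: n => //= n /(fP (n, u n))[].
pose t n := u n.+1 n.
have ut n i : (i < n)%N -> u n i = t i.
  elim: n => // n IH; rewrite ltnS leq_eqVlt => /predU1P[->//|ltin].
  by have [_ /= /(_ _ ltin) -> _] := fP (n, u n) (bu n); apply: IH.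
exists t; split=> [i j ltij|n t' bt' tt'].
  by rewrite -(ut j.+1 i) 1?ltnW // -(ut j.+1 j) // bu.
have [_ _ /(_ t' bt')] := fP (n, u n) (bu n); apply=> i /= ltin.
by rewrite ut // tt'.
Qed.

(** Nash-Williams: in a minimal bad sequence, pass to infinitely many words with
    the same first letter and remove that letter; the entries before
    the first of those words are kept. The result would be a smaller
    bad sequence. *)
Theorem higman s : exists i j, (i < j)%N /\ subseq (s i) (s j).
Proof.
apply: contrapT => ngood.
have /minimal_bad[t [bt tmin]] : bad s.
  by move=> i j ltij; apply/negP => sij; apply: ngood; exists i, j.
have tn0 n : t n != [::].
  by apply/eqP => tn; have := bt n n.+1 (ltnSn n); rewrite tn sub0seq.
have [a0 _] : exists a : A, true by have := tn0 0%N; case: (t 0%N) => // a; exists a.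
have [a [k [kmono kP]]] := infinite_fiber_mono (fun n => head a0 (t n)).
have tE i : t (k i) = a :: behead (t (k i)).
  by have := tn0 (k i); rewrite -(kP i); case: (t (k i)).
pose t' n := if (n < k 0)%N then t n else behead (t (k (n - k 0)%N)).
have /tmin : bad t'.
  move=> i j ltij; rewrite /t'; case: ltnP => [lti|lei]; case: ltnP => [ltj|lej].
  - exact: bt.
  - apply: contra (bt i (k (j - k 0)%N) _) => [/subseq_trans->//|].
      by rewrite [X in subseq _ X]tE subseq_cons.
    apply: leq_trans lti _; case: (j - k 0)%N => // d.
    exact/ltnW/kmono.
  - by have := leq_ltn_trans lei (ltn_trans ltij ltj); rewrite ltnn.
  - apply: contra (bt _ _ (kmono (i - k 0)%N (j - k 0)%N (ltn_sub2r _ ltij))) => [sij|].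
      by rewrite tE [X in subseq _ X]tE /= eqxx.
    exact: leq_ltn_trans lei ltij.
move/(_ (k 0%N)); have /[swap]/[apply] : agree (k 0%N) t t'.
  by move=> i lti; rewrite /t' lti.
by rewrite /t' ltnn subnn [X in (size X <= _)%N]tE /= ltnn.
Qed.
End Higman.

(** * Deletion of repeated letters *)

Section Words.
Variable A : finType.
Implicit Types (a c : A) (u v w : seq A) (X : {set A}) (T : seq A -> Prop).

(** Each letter is paired with the set of letters before it, so that an
    embedding of annotated words controls the letters that it skips. The
    final entry, with [None] in place of a letter, does this for the letters
    skipped after the last match. *)
Fixpoint annot X w : seq (option A * {set A}) :=
  if w is a :: v then (Some a, X) :: annot (a |: X) v else [:: (None, X)].

Lemma mem_annot X w p : p \in annot X w -> X \subset p.2.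
Proof.
elim: w X => [|a w IH] X /=; rewrite inE; first by move/eqP->.
by case/predU1P=> [->//|/IH]; apply: subset_trans; apply: subsetUr.
Qed.

Lemma subseq_annot X Y w w' :
  subseq (annot X w) (annot Y w') -> Y \subset X.
Proof.
have [x [s ->]] : exists x s, annot X w = (x, X) :: s.
  by case: w => [|a w]; [exists None, nil | exists (Some a); eexists].
move/mem_subseq/(_ _ (mem_head _ _)); exact: mem_annot.
Qed.

Definition closed_under_repeat_deletion T :=
  forall u c v, c \in u -> T (u ++ c :: v) -> T (u ++ v).

(** A letter of [w'] skipped by the embedding lies in the set attached to the
    next matched entry; that entry carries the same set in [w], hence
    the skipped letter occurs earlier in [w]. Working from left to right, it
    can therefore be deleted as a repetition. *)
Lemma subseq_annot_deletion T : closed_under_repeat_deletion T ->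
  forall w' w X Y u, subseq (annot X w) (annot Y w') -> {subset X <= u} ->
  T (u ++ w') -> T (u ++ w).
Proof.
move=> Tdel; elim=> [|c w' IH] w X Y u.
  by case: w => [|a w] //= /eqP.
have skip : subseq (annot X w) (annot (c |: Y) w') -> {subset X <= u} ->
    T (u ++ c :: w') -> T (u ++ w).
  move=> sww' Xu; rewrite -cat_rcons => Tw'.
  have cX : c \in X by apply: (subsetP (subseq_annot sww')); apply: setU11.
  apply: (Tdel u c) (Xu c cX) _; rewrite -cat_rcons.
  by apply: IH sww' _ Tw' => a /Xu; rewrite mem_rcons inE orbC => ->.
case: w skip => [|a w] skip; first exact skip.
rewrite [annot Y _]/= [annot X _]/= [subseq _ _]/=.
case: eqP => [[<- <-] sww' Xu|_]; last exact skip.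
rewrite -!cat_rcons; apply: IH sww' _ => b.
by rewrite mem_rcons !inE => /predU1P[->|/Xu->]; rewrite ?eqxx ?orbT.
Qed.

(** If the chain changed infinitely often, choose at each change a word that is
    lost; Higman's lemma gives two such words, of which the first is obtained
    from the second by deletions, although it has been lost earlier. *)
Lemma repeat_deletion_dcc (T : nat -> seq A -> Prop) :
  (forall n, closed_under_repeat_deletion (T n)) ->
  (forall n w, T n.+1 w -> T n w) ->
  exists N, forall n, (N <= n)%N -> forall w, T N w -> T n w.
Proof.
move=> Tdel TS; apply: contrapT => /forallNP nstab.
have Tmono m n w : (m <= n)%N -> T n w -> T m w.
  by elim: n => [|n IH]; rewrite leq_eqVlt => /predU1P[->//|//]; rewrite ltnS => /IH H /TS.
have /choice[f fP] N : exists p : nat * seq A,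
    [/\ (N <= p.1)%N, T N p.2 & ~ T p.1 p.2].
  have /existsNP[n nP] := nstab N; have [Nn] := (not_implyP _ _).1 nP.
  by case/existsNP=> w /not_implyP[TNw nTw]; exists (n, w).
pose k i := iter i (fun N => (f N).1) 0%N.
have kmono : {homo k : i j / (i <= j)%N}.
  by apply: homo_leq => [|? ? ?|l]; [|apply: leq_trans | have [] := fP (k l)].
pose w i := (f (k i)).2.
have [i [j [ltij sij]]] := higman (fun i => annot set0 (w i)).
have [_ _] := fP (k i); apply; apply: (Tmono _ (k j)); first exact: kmono ltij.
have [_ Tj _] := fP (k j).
apply: (subseq_annot_deletion (Tdel (k j)) sij (u := [::])) Tj.
by move=> a; rewrite inE.
Qed.

(** Base [#|A|] value: it orders words of equal length lexicographically. *)
Fixpoint code w : nat :=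
  if w is a :: v then enum_rank a * #|A| ^ size v + code v else 0.

Lemma code_lt w : code w < #|A| ^ size w.
Proof.
elim: w => //= a w IH; rewrite expnS.
apply: (@leq_trans ((enum_rank a).+1 * #|A| ^ size w)).
  by rewrite mulSn addnC ltn_add2r.
by rewrite leq_mul2r ltn_ord orbT.
Qed.

Lemma code_inj w w' : size w = size w' -> code w = code w' -> w = w'.
Proof.
elim: w w' => [|a w IH] [|a' w'] //= [sw]; rewrite -sw => ecode.
have lt1 := code_lt w; have lt2 : code w' < #|A| ^ size w by rewrite sw code_lt.
have q0 : 0 < #|A| ^ size w by apply: leq_ltn_trans lt1.
congr cons.
  apply/enum_rank_inj/val_inj => /=.
  by move/(congr1 (divn^~ (#|A| ^ size w))): ecode; rewrite !divnMDl // !divn_small // !addn0.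
apply: IH => //.
by move/(congr1 (modn^~ (#|A| ^ size w))): ecode; rewrite !modnMDl !modn_small.
Qed.

Lemma code_cat u v : code (u ++ v) = code u * #|A| ^ size v + code v.
Proof.
by elim: u => //= a u ->; rewrite mulnDl addnA size_cat expnD mulnA.
Qed.

(** The inserted letter is a function of the preceding ones, so that it cannot
    come before the first place where the two words differ while differing
    itself. *)
Lemma code_insert u v u' v' c c' : size u = size u' -> size v = size v' ->
  (u = u' -> c = c') -> code (u ++ v) < code (u' ++ v') ->
  code (u ++ c :: v) < code (u' ++ c' :: v').
Proof.
move=> su sv cc'.
have := code_lt v; have := code_lt v'; have := code_lt (c :: v).
rewrite !code_cat /= -sv expnS.
case: (ltngtP (code u) (code u')) => [ltu|ltu|eu].
- nia.
- nia.
have uu' := code_inj su eu; rewrite -uu' (cc' uu'); lia.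
Qed.
End Words.

Local Open Scope ring_scope.

(** * Functors spanned by tuples of vectors *)

(** The functor [G] is a quotient of [V |-> F_2[V^I]]: the span of [g U u], for
    all tuples [u], is detected by linear maps out of [G U]. *)
Definition tuple_spanned (I : finType) (G : functor) : Prop :=
  exists g : forall U : vectType F2, (I -> U) -> G U,
    (forall (U V : vectType F2) (f : 'Hom(U, V)) u,
       fmap G f (g U u) = g V (fun i => f (u i))) /\
    (forall (U : vectType F2) (M : lmodType F2) (h k : {linear G U -> M}),
       (forall u, h (g U u) = k (g U u)) -> h =1 k).

Lemma tuple_spanned_quotient I (F G : functor) (a : nattrans F G) :
  (forall V y, exists x, a V x = y) -> tuple_spanned I F -> tuple_spanned I G.
Proof.
move=> a_surj [g [gnat gspan]]; exists (fun U u => a U (g U u)).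
split=> [U V f u|U M h k hk y]; first by rewrite -ntappE gnat.
have [x <-] := a_surj U y.
exact: (gspan U M (h \o a U : {linear _ -> _}) (k \o a U : {linear _ -> _}) hk).
Qed.

Lemma tuple_spanned_tens I J (F G : functor) :
  tuple_spanned I F -> tuple_spanned J G ->
  tuple_spanned (I + J)%type (tensF F G).
Proof.
move=> [g [gnat gspan]] [g' [g'nat g'span]].
exists (fun U u => tens (g U (fun i => u (inl i))) (g' U (fun j => u (inr j)))).
split=> [U V f u|U M h k hk]; first by rewrite /= tens_mapE gnat g'nat.
apply: tens_ext => x y.
apply: (gspan U M (h \o tensl _ y : {linear _ -> _}) (k \o tensl _ y : {linear _ -> _})).
move=> u /=.
apply: (g'span U M (h \o tensr _ (g U u) : {linear _ -> _})
  (k \o tensr _ (g U u) : {linear _ -> _})).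
move=> v /=.
exact: (hk (fun s => match s with inl i => u i | inr j => v j end)).
Qed.

Lemma tuple_spanned_Lambda n : tuple_spanned 'I_n (Lambda n).
Proof.
exists (fun U u => wedge [ffun i => u i]); split=> [U V f u|U M h k hk].
  rewrite /= ext_mapE; congr wedge; apply/ffunP => i.
  by rewrite !ffunE.
apply: ext_ext => t; have := hk t; congr (h _ = k _).
all: by congr wedge; apply/ffunP => i; rewrite ffunE.
Qed.

Lemma tuple_spanned_ext2_Pbar : tuple_spanned bool (extF 2 Pbar).
Proof.
exists (fun U u => wedge2 (br (u false)) (br (u true))).
split=> [U V f u|U M h k hk]; first exact: ext_pbar_map.
by apply: pbar2_ext => x y; apply: (hk (fun b => if b then y else x)).
Qed.

Lemma tuple_spanned_P_21 : tuple_spanned bool P_21.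
Proof.
apply: (tuple_spanned_quotient (a := projP)) tuple_spanned_ext2_Pbar => V [y Py].
by case/asboolP: (Py) => x Pix; exists x; apply: subspace_ext.
Qed.

Lemma tuple_spanned_Gbar_2 : tuple_spanned bool Gbar_2.
Proof.
apply: (tuple_spanned_quotient (a := projG)) tuple_spanned_ext2_Pbar => V [y Py].
exists y; apply: subspace_ext; case/eqP: (Py) => Piy.
by change (y - Pi V y = y); rewrite Piy subr0.
Qed.

(** * Duals of tuple-spanned functors *)

Section Dual.
Variable I : finType.
Notation A := {ffun I -> F2}.
Implicit Types (c : A) (u v w : seq A).

Definition covector_mx m w i : 'cV[F2]_m := \col_j nth 0 w j i.

Fact covector_linear m w i :
  linear (fun x : 'rV[F2]_m => (x *m covector_mx m w i) 0 0 : F2^o).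
Proof. by move=> a x y; rewrite mulmxDl -scalemxAl !mxE. Qed.

(** The word [w], of length [m], is read as the tuple of [m] columns of a matrix;
    its rows are linear forms on [F_2^m]. *)
Definition word_tuple m w (i : I) : vdual 'rV[F2]_m :=
  linfun (mklin (@covector_linear m w i)).

Lemma word_tupleE m w i x :
  word_tuple m w i x = (x *m covector_mx m w i) 0 0.
Proof. by rewrite lfunE. Qed.

Lemma word_tuple_surj m (u : I -> vdual 'rV[F2]_m) :
  exists2 w, size w = m & forall i, word_tuple m w i = u i.
Proof.
exists [seq [ffun i => u i (delta_mx 0 j)] | j <- enum 'I_m].
  by rewrite size_map size_enum_ord.
move=> i; apply/lfunP => x; rewrite word_tupleE {2}(row_sum_delta x) linear_sum.
rewrite mxE; apply: eq_bigr => j _; rewrite linearZ mxE; congr (_ * _).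
by rewrite (nth_map j) ?size_enum_ord // ffunE nth_ord_enum.
Qed.

(** Position [k] of [u ++ c :: v] carries the letter at position [origin u c k]
   of [u ++ v] when [c] occurs in [u]; the new [c] is copied from its first
   occurrence there. *)
Definition origin (u : seq A) c k :=
  if (k < size u)%N then k else if k == size u then index c u else k.-1.

Definition deletion_mx m' m (u : seq A) c : 'M[F2]_(m', m) :=
  \matrix_(k, j) (origin u c k == j)%:R.

Definition deletion u c v :
    'Hom('rV[F2]_(size (u ++ c :: v)), 'rV[F2]_(size (u ++ v))) :=
  linfun (mulmxr (deletion_mx _ _ u c)).

Lemma deletion_mxE u c v u1 v1 : c \in u -> size u1 = size u -> size v1 = size v ->
  forall i, deletion_mx (size (u ++ c :: v)) (size (u ++ v)) u c
      *m covector_mx _ (u1 ++ v1) i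
    = covector_mx _ (u1 ++ nth 0 u1 (index c u) :: v1) i.
Proof.
move=> cu su sv i; apply/matrixP => k z; rewrite !mxE.
have ltk : (origin u c k < size (u ++ v))%N.
  have := ltn_ord k; move: (nat_of_ord k) => l; rewrite !size_cat /= /origin.
  by case: (ltngtP l (size u)) => [||_ _]; [lia.. | rewrite ltn_addr ?index_mem].
rewrite (bigD1 (Ordinal ltk)) //= big1 ?addr0 => [|j jk]; last first.
  by rewrite !mxE (_ : (_ == _) = false) ?mul0r //; apply/eqP => e;
    case/eqP: jk; apply: val_inj.
rewrite !mxE eqxx mul1r /= {ltk} /origin !nth_cat su.
case: (ltngtP k (size u)) => [->//|ltk'|->]; last by rewrite index_mem cu subnn.
have -> : (k.-1 < size u)%N = false by lia.
by have -> : (k - size u = (k.-1 - size u).+1)%N by lia.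
Qed.

Variable G : functor.
Variable g : forall U : vectType F2, (I -> U) -> G U.
Hypothesis g_nat : forall (U V : vectType F2) (f : 'Hom(U, V)) (t : I -> U),
  fmap G f (g t) = g (fun i => f (t i)).
Hypothesis g_span :
  forall (U : vectType F2) (M : lmodType F2) (h k : {linear G U -> M}),
    (forall t, h (g t) = k (g t)) -> h =1 k.

Definition ev m (x : dualF G 'rV[F2]_m) w : F2 :=
  (x : {linear _ -> _}) (g (word_tuple m w)).

Lemma ev_inj m (x : dualF G 'rV[F2]_m) :
  (forall w, size w = m -> ev x w = 0) -> x = 0.
Proof.
move=> x0; apply: lin_ext; apply: (g_span (k := (0 : ldual _) : {linear _ -> _})) => t.
have [w sw /funext <-] := word_tuple_surj t; exact: x0.
Qed.

Lemma ev_deletion u c v u1 v1 (x : dualF G 'rV[F2]_(size (u ++ c :: v))) :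
  c \in u -> size u1 = size u -> size v1 = size v ->
  ev (fmap (dualF G) (deletion u c v) x) (u1 ++ v1)
  = ev x (u1 ++ nth 0 u1 (index c u) :: v1).
Proof.
move=> cu su sv; rewrite /ev /= g_nat; congr ((x : {linear _ -> _}) (g _)).
apply/funext => i; apply/lfunP => y.
rewrite vdual_mapE comp_lfunE !word_tupleE lfunE /= -mulmxA.
by rewrite deletion_mxE.
Qed.

Lemma evB m (x y : dualF G 'rV[F2]_m) w : ev (x - y) w = ev x w - ev y w.
Proof. by []. Qed.

(** Evaluation on words identifies elements with functions on words. Least
    words of supports play the part of leading monomials in Groebner
    theory. *)
Definition leading (S : subfunctor (dualF G)) w : Prop :=
  exists x : dualF G 'rV[F2]_(size w),
    [/\ x \in S _, ev x w != 0
      & forall w1, size w1 = size w -> (code w1 < code w)%N -> ev x w1 = 0].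

(** The linear map of [ev_deletion] pulls words of length [size (u ++ v)] back by
    repeating the letter at a fixed position, which preserves the
    lexicographic order. *)
Lemma leading_deletion S : closed_under_repeat_deletion (leading S).
Proof.
move=> u c v cu [x [Sx xw xmin]].
exists (fmap (dualF G) (deletion u c v) x); split; first exact: subf_stable.
  by rewrite ev_deletion // nth_index.
move=> w1 sw1 ltw1; pose u1 := take (size u) w1; pose v1 := drop (size u) w1.
have su : size u1 = size u by rewrite size_takel // sw1 size_cat leq_addr.
have sv : size v1 = size v by rewrite size_drop sw1 size_cat addKn.
rewrite -(cat_take_drop (size u) w1) ev_deletion //; apply: xmin.
  by rewrite !size_cat /= su sv.
apply: code_insert => //; last by rewrite cat_take_drop.
by rewrite -/u1 => ->; rewrite nth_index.
Qed.

(** Division algorithm: subtracting elements of [S'] removes the least words of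
    the support of an element of [S], one after the other. *)
Lemma leading_sub (S S' : subfunctor (dualF G)) : (forall V, {subset S' V <= S V}) ->
  (forall w, leading S w -> leading S' w) ->
  forall m, {subset S 'rV[F2]_m <= S' 'rV[F2]_m}.
Proof.
move=> SS leadS m.
(* Induction on [k]: [x] vanishes at the words of code below [#|A| ^ m - k]. *)
suff main k (x : dualF G 'rV[F2]_m) : x \in S _ ->
    (forall w, size w = m -> (code w + k < #|A| ^ m)%N -> ev x w = 0) ->
    x \in S' _.
  move=> x Sx; apply: (main (#|A| ^ m)%N) => // w _.
  by rewrite ltnNge leq_addl.
elim: k x => [|k IH] x Sx xk.
  by rewrite (ev_inj (x := x)) ?rpred0 // => w sw; rewrite xk // addn0 -sw code_lt.
have [[w [sw wk xw]]|now] := pselect (exists w,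
    [/\ size w = m, (code w + k.+1 = #|A| ^ m)%N & ev x w != 0]); last first.
  apply: IH => // w sw wk; have [//|xw] := eqVneq (ev x w) 0.
  move: wk; rewrite -ltnS -addnS ltnS leq_eqVlt => /predU1P[wk|/xk->//].
  by case: now; exists w.
have /leadS[y [S'y yw ymin]] : leading S w.
  rewrite /leading; move: x Sx xk xw {IH}; rewrite -sw => x Sx xk xw.
  exists x; split=> // w1 sw1 ltw1; apply: xk => //.
  by rewrite sw -wk ltn_add2r.
move: S'y yw ymin; move: (y); rewrite sw => {}y S'y yw ymin.
(* Two nonzero scalars are equal, so that [x - y] vanishes at [w]. *)
have F2_1 (a : F2) : a != 0 -> a = 1.
  by case: a => -[|[|//]] lt_a // _; apply: val_inj.
rewrite -(subrK y x) rpredD //; apply: IH => [|w1 sw1 ltw1].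
  by rewrite oppv rpredD // SS.
rewrite evB; have [w1k|] := ltnP (code w1 + k.+1) (#|A| ^ m)%N.
  by rewrite xk // ymin // ?subrr // -(ltn_add2r k.+1) wk.
rewrite addnS => w1k; have w1w : w1 = w.
  by apply: code_inj; rewrite ?sw //; lia.
by rewrite w1w (F2_1 _ xw) (F2_1 _ yw) subrr.
Qed.
End Dual.

Lemma subfunctor_eq_rV (F : functor) (S S' : subfunctor F) :
  (forall m, {subset S 'rV[F2]_m <= S' 'rV[F2]_m}) ->
  forall V, {subset S V <= S' V}.
Proof.
move=> SS V x Sx; pose f : 'Hom(V, _) := linfun (@v2r _ V).
pose f' : 'Hom(_, V) := linfun (@r2v _ V).
have <- : fmap F f' (fmap F f x) = x.
  rewrite -fmap_comp (_ : (_ \o _)%VF = \1%VF) ?fmap_id //.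
  by apply/lfunP => y; rewrite comp_lfunE !lfunE /= v2rK.
by apply: subf_stable; apply: SS; apply: subf_stable.
Qed.

Theorem dual_tuple_spanned_artinian I (G : functor) :
  tuple_spanned I G -> artinian (dualF G).
Proof.
case=> g [g_nat g_span]; apply/artinianP => S dS.
have mS m n V : (m <= n)%N -> {subset S n V <= S m V}.
  move=> /subnK <-; elim: (n - m)%N => // k IH x /dS; exact: IH.
have [|n w [x [Sx xw xmin]]|N NP] := @repeat_deletion_dcc _ (fun n => leading g (S n)).
- by move=> n; apply: leading_deletion.
- by exists x; split=> //; apply: dS.
exists N => n Nn V x; apply/idP/idP; first exact: mS.
apply: subfunctor_eq_rV => m; apply: (leading_sub g_span) (NP n Nn) _.
by move=> W; apply: mS.
Qed.

Lemma artinian_subfunctor (F : functor) (K : subfunctor F) :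
  artinian F -> artinian (subf_obj K).
Proof.
move=> aF S dS.
pose j n := nt_comp (subf_incl K) (so_arr (S n)).
have jm n : mono (j n).
  move=> H b c bc; apply: (@so_mono _ (S n)) => V x.
  by apply: subspace_ext; apply: bc.
have leE A B : so_le (Subobject (jm A)) (Subobject (jm B)) -> so_le (S A) (S B).
  by case=> h hE; exists h => V x; apply: subspace_ext; apply: hE.
have [|N NP] := aF (fun n => Subobject (jm n)).
  by move=> n; have [h hE] := dS n; exists h => V x; exact: (congr1 (@subval _ _) (hE V x)).
by exists N => n /NP[/leE le1 /leE le2].
Qed.

Theorem mainTheorem2 (n : nat) : artinian (L2n n) /\ artinian (D2n n).
Proof.
have tens F : tuple_spanned bool F ->
    artinian (dualF (tensF F (Lambda n))).
  move=> Fs; apply: dual_tuple_spanned_artinian.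
  exact: tuple_spanned_tens Fs (tuple_spanned_Lambda n).
have [sL sD] := (tuple_spanned_P_21, tuple_spanned_Gbar_2).
case: n tens => [|n] tens; first by split;
  [exact: dual_tuple_spanned_artinian sL | exact: dual_tuple_spanned_artinian sD].
by split; apply: artinian_subfunctor; apply: tens.
Qed.
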